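(* In the setting of the context (reflecting, i.e. Neumann, boundary at $0$ and Dirichlet boundary at $N+1$ if $N<\infty$), let $(\mathbb B,\|\cdot\|_{\mathbb B},\mu)$ be a normed linear space of functions on $E$ satisfying (H1)--(H3), where $\mathscr G$ contains a locally positive element. Then the isoperimetric constant $$B_{\mathbb B}:=\sup_K\frac{\|\mathbb 1_K\|_{\mathbb B}}{\mathrm{Cap}(K)}$$ (supremum over nonempty compact $K\subset E$) can be expressed as $$B_{\mathbb B}=\sup_{0\le n<N+1}\ \sum_{i=n}^N\frac1{\mu_ib_i}\,\|\mathbb 1_{[0,n]}\|_{\mathbb B}.$$ In particular, for the Sobolev-type inequality, i.e. for $\mathbb B=L^{p/2}(\mu)$ with $p\ge2$, this constant equals $$B_p=\sup_{0\le n<N+1}\ \sum_{i=n}^N\frac1{\mu_ib_i}\Big(\sum_{j=0}^n\mu_j\Big)^{2/p}.$$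
   Context: $E=\{i\in\mathbb Z:0\le i<N+1\}$, $N\le\infty$; birth rates $b_i>0$ for all $i\in E$ (in particular $b_N>0$ if $N<\infty$), death rates $a_i>0$ for $1\le i\in E$, $a_0=0$. $\mu_0=1$, $\mu_n=\frac{b_0\cdots b_{n-1}}{a_1\cdots a_n}$. $D(f)=\sum_{i\in E}\mu_ib_i(f_{i+1}-f_i)^2$ with $f_{N+1}:=0$ if $N<\infty$. $\mathrm{Cap}(K)=\inf\{D(f):\ f\text{ finitely supported on }E,\ f\ge1\text{ on }K\}$ for compact (i.e. finite) $K$. Hypotheses on $\mathbb B$: (H1) if $\mu(E)=\infty$, then $\mathbb 1_K\in\mathbb B$ for all compact $K$; otherwise $1\in\mathbb B$. (H2) If $h\in\mathbb B$ and $|f|\le h$, then $f\in\mathbb B$. (H3) $\|f\|_{\mathbb B}=\sup_{g\in\mathscr G}\sum_{i\in E}\mu_i|f_i|g_i$ for a class $\mathscr G$ of nonnegative functions on $E$. ''$\mathscr G$ contains a locally positive element'' means that some $g\in\mathscr G$ satisfies $\inf_Kg>0$ for every compact $K$. Convention $1/0=\infty$. *)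

(* Defs.v *)
From HB Require Import structures.
From mathcomp Require Import all_boot all_order all_algebra.
From mathcomp Require Import all_classical all_reals all_analysis.

Set Implicit Arguments.
Unset Strict Implicit.
Unset Printing Implicit Defensive.

Import Order.TTheory GRing.Theory Num.Theory.
Import numFieldNormedType.Exports.

Local Open Scope classical_set_scope.
Local Open Scope ring_scope.

(* N : option nat encodes N <= oo, with None standing for N = oo. *)
Definition inE (N : option nat) (i : nat) : bool :=
  if N is Some m then (i <= m)%N else true.

Definition E (N : option nat) : Type := {i : nat | inE N i}.

HB.instance Definition _ N := SubCountable.on (E N).

Lemma inE0 N : inE N 0%N. Proof. by case: N. Qed.

HB.instance Definition _ N := isPointed.Build (E N) (Sub 0%N (inE0 N) : E N).

HB.instance Definition _ N := @isMeasurable.Build default_measure_display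
  (E N) discrete_measurable discrete_measurable0
  discrete_measurableC discrete_measurableU.

(* The rates are functions on nat, but only their values on E N are
   constrained or used. *)
Record birth_death (R : realType) (N : option nat) := BirthDeath {
  birth : nat -> R;
  death : nat -> R;
  birth_gt0 : forall i, inE N i -> 0 < birth i;
  death0 : death 0%N = 0;
  death_gt0 : forall i, (1 <= i)%N -> inE N i -> 0 < death i }.

Definition mu_ (R : realType) (N : option nat) (X : birth_death R N) (n : nat) : R :=
  (\prod_(0 <= k < n) birth X k) / (\prod_(1 <= k < n.+1) death X k).

Lemma inE_le N i j : (i <= j)%N -> inE N j -> inE N i.
Proof. by case: N => //= m; exact: leq_trans. Qed.

Lemma mu_gt0 (R : realType) N (X : birth_death R N) n : inE N n -> 0 < mu_ X n.
Proof.
move=> Nn; rewrite /mu_ divr_gt0// big_nat; apply: prodr_gt0 => k /andP[k1 k2].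
  by apply: birth_gt0; apply: inE_le Nn; exact: ltnW.
by apply: death_gt0 => //; apply: inE_le Nn.
Qed.

Section invariant_measure.
Variables (R : realType) (N : option nat) (X : birth_death R N).
Local Open Scope ereal_scope.

Definition mu (A : set (E N)) : \bar R := \esum_(i in A) (mu_ X (\val i))%:E.

Let mu_i_ge0 (i : E N) : 0 <= (mu_ X (\val i))%:E.
Proof. by rewrite lee_fin ltW// mu_gt0//; exact: valP. Qed.

Let mu0 : mu set0 = 0. Proof. exact: esum_set0. Qed.

Let mu_ge0 A : 0 <= mu A. Proof. by apply: esum_ge0 => i _. Qed.

Let mu_sigma_additive : semi_sigma_additive mu.
Proof.
move=> F mF tF mUF; rewrite /mu esum_bigcupT//.
have <- : \sum_(0 <= k <oo) mu (F k) = \esum_(k in [set: nat]) mu (F k).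
  by rewrite nneseries_esumT// => k _; exact: mu_ge0.
by apply: is_cvg_nneseries => n _ _; exact: mu_ge0.
Qed.

HB.instance Definition _ := isMeasure.Build _ _ _ mu mu0 mu_ge0 mu_sigma_additive.

End invariant_measure.

Section capacity.
Variables (R : realType) (N : option nat) (X : birth_death R N).
Local Open Scope ereal_scope.

(* Extension by 0 outside E: the Dirichlet convention f_{N+1} = 0 when N < oo. *)
Definition ext (f : E N -> R) (i : nat) : R :=
  if insub i is Some j then f j else 0%R.

Definition dirichlet (f : E N -> R) : \bar R :=
  \esum_(i in [set: E N])
    (mu_ X (\val i) * birth X (\val i) * (ext f (\val i).+1 - f i) ^+ 2)%:E.

Definition capacity (K : set (E N)) : \bar R :=
  ereal_inf [set dirichlet f | f in
    [set f | finite_set [set i | f i != 0%R] /\ forall i, K i -> (1 <= f i)%R]].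

(* With the library's 0^-1 = +oo, the ratio is +oo when the capacity is 0
   and the norm is positive. *)
Definition isoperimetric_constant (norm : (E N -> R) -> \bar R) : \bar R :=
  ereal_sup [set norm (\1_K) / capacity K | K in
    [set K : set (E N) | finite_set K /\ K !=set0]].

Definition interval0 (n : E N) : set (E N) := [set i | (\val i <= \val n)%N].

Definition resistance (n : E N) : \bar R :=
  \esum_(i in [set i : E N | (\val n <= \val i)%N])
    (1 / (mu_ X (\val i) * birth X (\val i)))%:E.

End capacity.

Section function_spaces.
Variables (R : realType) (N : option nat) (X : birth_death R N).
Implicit Types (B G : set (E N -> R)) (norm : (E N -> R) -> R).

(* The values of norm outside B are irrelevant. *)
Record normed_function_space B norm : Prop := NormedFunctionSpace {
  nfs_zero : B (cst 0);
  nfs_linear : forall (c : R) f g, B f -> B g -> B (fun i => c * f i + g i);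
  nfs_triangle : forall f g, B f -> B g ->
    norm (fun i => f i + g i) <= norm f + norm g;
  nfs_homogeneous : forall (c : R) f, B f ->
    norm (fun i => c * f i) = `|c| * norm f;
  nfs_definite : forall f, B f -> norm f = 0 -> f = cst 0 }.

Definition H1 B : Prop :=
  (mu X [set: E N] = +oo%E -> forall K, finite_set K -> B (\1_K)) /\
  (mu X [set: E N] <> +oo%E -> B (cst 1)).

Definition H2 B : Prop :=
  forall h f, B h -> (forall i, `|f i| <= h i) -> B f.

Definition H3 B norm G : Prop :=
  (forall g, G g -> forall i, 0 <= g i) /\
  (forall f, B f -> (norm f)%:E =
    ereal_sup [set (\esum_(i in [set: E N])
                      (mu_ X (\val i) * `|f i| * g i)%:E)%E | g in G]).

(* The infimum is taken in \bar R, so it is +oo for K empty. *)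
Definition locally_positive (g : E N -> R) : Prop :=
  forall K, finite_set K -> (0 < ereal_inf [set (g i)%:E | i in K])%E.

End function_spaces.

(* Main.v *)
(* Let R(n) be the sum of the 1/(mu_i b_i) over i >= n. If f is finitely
   supported and f_n >= 1, telescoping f from n to the Dirichlet end and
   Cauchy-Schwarz give D(f) >= 1/R(n). Conversely, for a finite set A of sites
   beyond n, the function decreasing by 1/(S mu_i b_i) across each i in A, where
   S is the sum of the 1/(mu_i b_i) over A, is 1 on [0, n] and has energy 1/S;
   letting S tend to R(n), Cap([0, n]) = 1/R(n). A finite K with maximum n lies
   in [0, n] and already satisfies Cap(K) >= 1/R(n), so replacing K by [0, n]
   can only increase the ratio as soon as the norm is monotone on indicators. *)
Require Import Defs.
From HB Require Import structures.
From mathcomp Require Import all_boot all_order all_algebra.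
From mathcomp Require Import all_classical all_reals all_analysis.
From mathcomp Require Import ring.

Import Order.TTheory GRing.Theory Num.Theory.
Import numFieldNormedType.Exports.

Local Open Scope classical_set_scope.
Local Open Scope ring_scope.

Set Implicit Arguments.
Unset Strict Implicit.

(** * Finite sums, supports and intervals in the state space *)

Lemma ext_val (R : realType) (N : option nat) (f : E N -> R) (i : E N) :
  ext f (val i) = f i.
Proof. by rewrite /ext valK. Qed.

Lemma sum_pmap_insub (V : nmodType) (N : option nat) (a : nat -> V) n M :
  Defs.inE N M ->
  \sum_(i <- (pmap insub (index_iota n M.+1) : seq (E N))) a (val i) =
  \sum_(n <= i < M.+1) a i.
Proof.
move=> NM; rewrite big_pmap big_seq [RHS]big_seq; apply: eq_bigr => i.
rewrite mem_index_iota ltnS => /andP[_ iM].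
by rewrite insubT ?(inE_le iM)//= SubK.
Qed.

(** Brings lower bounds on sums over [E] down to sums over consecutive naturals, where telescoping
    is available. *)
Lemma sum_nat_le_esum (R : realType) (N : option nat) (A : set (E N))
    (a : nat -> R) (n M : nat) :
  Defs.inE N M -> (forall i : E N, (n <= val i)%N -> A i) ->
  ((\sum_(n <= i < M.+1) a i)%:E <= \esum_(i in A) (a (val i))%:E)%E.
Proof.
move=> NM nA; pose s : seq (E N) := pmap insub (index_iota n M.+1).
apply: esum_ge; exists [set` s].
  split; first exact: finite_seq.
  move=> i /=; rewrite mem_pmap_sub mem_index_iota => /andP[ni _].
  exact: nA.
by rewrite -fsbig_seq ?pmap_sub_uniq ?iota_uniq// sumEFin sum_pmap_insub.
Qed.

(** Supplies the last index of the telescoping sum. The value at [M.+1] vanishes either because [M]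
    bounds the support or because [M] is the last site of [E], by the Dirichlet convention. *)
Lemma support_bound (R : realType) (N : option nat) (f : E N -> R) (n : E N) :
  finite_set [set i | f i != 0] ->
  exists M, [/\ Defs.inE N M, (val n <= M)%N & ext f M.+1 = 0].
Proof.
case/finite_seqP => s sE.
pose k := maxn (val n) (\max_(i <- s) val i).
have nk : (val n <= k)%N by exact: leq_maxl.
have fk (i : E N) : (k < val i)%N -> f i = 0.
  move=> ki; apply: contraTeq ki => fi; rewrite -leqNgt.
  have si : i \in s by have : [set i | f i != 0] i by []; rewrite sE.
  rewrite (leq_trans _ (leq_maxr _ _))//.
  exact: (@leq_bigmax_seq _ s xpredT (fun j : E N => val j) i).
have [kN|kN] := boolP (Defs.inE N k).
  exists k; split => //.
  rewrite /ext; case: insubP => // i _ ik; apply: fk.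
  by rewrite ik.
clearbody k; clear s sE.
case: N n f nk kN fk => // m n f nk kN fk; exists m; split.
- exact: leqnn.
- exact: (valP n).
- by rewrite /ext insubF//= ltnn.
Qed.

Lemma interval0E (N : option nat) (n : E N) :
  interval0 n = [set` (pmap insub (index_iota 0 (val n).+1) : seq (E N))].
Proof.
set s := pmap _ _; have sE i : (i \in s) = (val i <= val n)%N.
  by rewrite mem_pmap_sub mem_index_iota ltnS.
apply/funext => i; apply/propext.
by rewrite -[X in _ <-> X]/(is_true (i \in s)) sE.
Qed.

Lemma finite_interval0 (N : option nat) (n : E N) : finite_set (interval0 n).
Proof. by rewrite interval0E; exact: finite_seq. Qed.

Lemma finite_set_has_max (N : option nat) (K : set (E N)) :
  finite_set K -> K !=set0 -> exists2 n, K n & K `<=` interval0 n.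
Proof.
case/finite_seqP => s ->; elim: s => [[x]//|x [|y s] IH _].
  exists x; first exact: mem_head.
  by move=> i /=; rewrite mem_seq1 => /eqP->; exact: leqnn.
have [|n ns sn] := IH; first by exists y; exact: mem_head.
have [xn|nx] := leqP (val x) (val n).
  exists n; first by rewrite /= in_cons; apply/orP; right.
  by move=> i; rewrite /= in_cons => /orP[/eqP->|/sn].
exists x; first exact: mem_head.
move=> i; rewrite /= in_cons => /orP[/eqP->|/sn /leq_trans]; first exact: leqnn.
by apply; exact: ltnW.
Qed.

(** * Capacity and resistance *)

Section birth_death_capacity.
Variables (R : realType) (N : option nat) (X : birth_death R N).

Let weight i := mu_ X i * birth X i.

Let weight_gt0 i : Defs.inE N i -> 0 < weight i.
Proof. by move=> Ni; rewrite mulr_gt0// ?mu_gt0// birth_gt0. Qed.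

Let weight_val_gt0 (i : E N) : 0 < weight (val i).
Proof. exact/weight_gt0/valP. Qed.

Let mu_val_ge0 (i : E N) : 0 <= mu_ X (val i).
Proof. by apply/ltW/mu_gt0; exact: valP. Qed.

Lemma resistance_ge0 n : (0 <= resistance X n)%E.
Proof.
by apply: esum_ge0 => i _; rewrite lee_fin divr_ge0//; exact/ltW/weight_val_gt0.
Qed.

Lemma dirichlet_ge0 f : (0 <= dirichlet X f)%E.
Proof.
apply: esum_ge0 => i _; rewrite lee_fin mulr_ge0 ?sqr_ge0//.
exact/ltW/weight_val_gt0.
Qed.

Lemma capacity_ge0 K : (0 <= capacity X K)%E.
Proof.
by apply: le_ereal_inf_tmp => _ [f _ <-]; exact: dirichlet_ge0.
Qed.

(* Cauchy-Schwarz, linearised: with x = f_{i+1} - f_i, the inequality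
   w (x + c/w)^2 >= 0 reads w x^2 >= - 2 c x - c^2/w, whose right-hand side
   telescopes; the best constant is c = 1/S, with S the sum of the 1/w. *)
Lemma resistance_inv_le_dirichlet n f :
  finite_set [set i | f i != 0] -> 1 <= f n ->
  ((resistance X n)^-1 <= dirichlet X f)%E.
Proof.
move=> finf fn1; have [M [NM nM fM]] := support_bound n finf.
pose S := \sum_(val n <= i < M.+1) 1 / weight i.
have S0 : 0 < S.
  rewrite /S big_nat_recr//= ltr_wpDl ?divr_gt0 ?weight_gt0//.
  rewrite big_nat sumr_ge0// => i /andP[_ /ltnW iM].
  by rewrite divr_ge0// ltW// weight_gt0// (inE_le iM).
have SR : (S%:E <= resistance X n)%E.
  exact: (@sum_nat_le_esum _ _ _ (fun i => 1 / weight i)).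
(* [S] is only a partial sum of the resistance, but it is finite and positive, so a real inequality
   remains even when the resistance is infinite. *)
apply: (@le_trans _ _ (S^-1)%:E).
  have -> : (S^-1)%:E = (S%:E^-1)%E by rewrite inver gt_eqF.
  by rewrite lee_pV2 ?inE/= ?resistance_ge0// lee_fin ltW.
pose a i := weight i * (ext f i.+1 - ext f i) ^+ 2.
have -> : dirichlet X f = \esum_(i in [set: E N]) (a (val i))%:E.
  by apply: eq_esum => i _; rewrite /a ext_val.
apply: le_trans (@sum_nat_le_esum _ _ _ a (val n) M NM _) => //.
rewrite lee_fin.
pose b i := - (2 / S) * (ext f i.+1 - ext f i) - S^-1 ^+ 2 * (1 / weight i).
apply: (@le_trans _ _ (\sum_(val n <= i < M.+1) b i)); last first.
  apply: ler_sum_nat => i /andP[_]; rewrite ltnS => iM.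
  have w0 := weight_gt0 (inE_le iM NM); rewrite /a /b.
  set x := ext f i.+1 - ext f i; rewrite -subr_ge0.
  have -> : weight i * x ^+ 2 - (- (2 / S) * x - S^-1 ^+ 2 * (1 / weight i)) =
      weight i * (x + S^-1 / weight i) ^+ 2.
    by field; rewrite !gt_eqF.
  by rewrite mulr_ge0 ?sqr_ge0// ltW.
rewrite /b sumrB -2!mulr_sumr telescope_sumr ?(leqW nM)// -/S fM ext_val sub0r.
(* The excess over 1/S is 2 (f_n - 1)/S, nonnegative since f_n >= 1. *)
have -> : - (2 / S) * - f n - S^-1 ^+ 2 * S = S^-1 + 2 * (f n - 1) * S^-1.
  by field; rewrite gt_eqF.
by rewrite lerDl !mulr_ge0 ?subr_ge0// invr_ge0 ltW.
Qed.

Lemma resistance_inv_le_capacity n K :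
  K n -> ((resistance X n)^-1 <= capacity X K)%E.
Proof.
move=> Kn; apply: le_ereal_inf_tmp => _ [f [finf f1] <-].
exact: resistance_inv_le_dirichlet finf (f1 _ Kn).
Qed.

Lemma capacity_interval0_le n :
  (capacity X (interval0 n) <= (resistance X n)^-1)%E.
Proof.
(* Inverting puts the resistance on the left, where it is a supremum over finite sets [A]: one test
   function per [A] suffices, and no limit is taken. *)
rewrite inve_pge ?inE ?resistance_ge0 ?capacity_ge0//.
apply: ge_ereal_sup => _ [A [finA An] <-].
rewrite fsbig_finite//=; set r := finmap.enum_fset _.
have rA i : (i \in r) = (i \in A) by rewrite in_fset_set.
have ur : uniq r by exact: finmap.fset_uniq.
pose v (i : E N) := 1 / weight (val i).
have v0 i : 0 < v i by rewrite divr_gt0.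
have -> : (\sum_(i <- r) (1 / (mu_ X (val i) * birth X (val i)))%:E)%E =
          (\sum_(i <- r) v i)%:E by rewrite -sumEFin.
set S := \sum_(i <- r) v i.
have S_ge0 : 0 <= S by apply: sumr_ge0 => i _; rewrite ltW.
have [->|S0] := eqVneq S 0; first by rewrite inve_ge0 capacity_ge0.
have {S_ge0}S0 : 0 < S by rewrite lt0r S0.
rewrite inve_pge ?inE ?lee_fin ?capacity_ge0//; last exact: ltW.
rewrite inver gt_eqF//.
pose F (i : nat) := (\sum_(j <- r | (i <= val j)%N) v j) / S.
pose f (i : E N) := F (val i).
(* Beyond the end of [E] no site of [A] remains, so [F] meets the Dirichlet convention by itself. *)
have extF i : ext f i = F i.
  rewrite /ext; case: insubP => [j _ <-//|Ni].
  rewrite /F big1 ?mul0r// => j ij; exfalso.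
  by move: Ni; rewrite (inE_le ij (valP j)).
(* Off the diagonal strict and large inequality agree, so in F(i+1) - F(i) only the term j = i
   survives. *)
have val_leq (i j : E N) : i != j -> (val i <= val j)%N = (val i < val j)%N.
  move=> ij; rewrite leq_eqVlt; suff /negPf-> : val i != val j by [].
  by apply: contraNneq ij => /val_inj ->.
have dF (i : E N) :
    F (val i).+1 - F (val i) = if i \in A then - (v i / S) else 0.
  rewrite /F -mulrBl big_mkcond [X in _ - X]big_mkcond -sumrB/=.
  case: ifPn => iA.
    rewrite (bigD1_seq i) ?rA//= big1 => [|j ji].
      by rewrite ltnn leqnn sub0r addr0 mulNr.
    by rewrite val_leq 1?eq_sym// subrr.
  rewrite big_seq big1 ?mul0r// => j; rewrite rA => jA.
  have ji : i != j by apply: contraNneq iA => ->.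
  by rewrite val_leq// subrr.
apply: (@le_trans _ _ (dirichlet X f)).
  apply: ereal_inf_lbound; exists f => //; split.
    (* Where [f] is nonzero, some site of [A] lies at or beyond [i]. *)
    apply: (@sub_finite_set _ _ (\bigcup_(j in A) interval0 j)); last first.
      by apply: bigcup_finite => // j _; exact: finite_interval0.
    move=> i /=; apply: contra_neqP => Ai.
    rewrite /f /F big_seq_cond big1 ?mul0r// => j /andP[]; rewrite rA inE => jA ij.
    by exfalso; apply: Ai; exists j.
  move=> i /= ni; rewrite /f /F big_seq_cond.
  have -> : \sum_(j <- r | (j \in r) && (val i <= val j)%N) v j = S.
    rewrite /S big_seq; apply: eq_bigl => j; case jr: (j \in r) => //=.
    by apply: leq_trans ni _; apply: An; rewrite -inE -rA.
  by rewrite divff// gt_eqF.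
have -> : dirichlet X f = \esum_(i in A) (v i / S ^+ 2)%:E.
  rewrite [RHS]esum_mkcond; apply: eq_esum => i _.
  rewrite extF dF; case: ifPn => _; last by rewrite expr0n mulr0.
  congr EFin; rewrite -/(weight _) sqrrN /v.
  by field; rewrite !gt_eqF.
rewrite esum_fset// => [|i _]; last by rewrite lee_fin divr_ge0 ?sqr_ge0// ltW.
rewrite fsbig_finite//= -/r sumEFin lee_fin -mulr_suml -/S.
by rewrite expr2 invfM mulrA divff ?mul1r// gt_eqF.
Qed.

Lemma capacity_interval0 n :
  capacity X (interval0 n) = ((resistance X n)^-1)%E.
Proof.
apply/le_anti/andP; split; first exact: capacity_interval0_le.
by apply: resistance_inv_le_capacity; exact: leqnn.
Qed.

(** Asks for nonnegativity and monotonicity on indicators only, with values in [\bar R], so that it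
    serves both the abstract norm and the L^{p/2} norm. *)
Lemma isoperimetric_constantE (norm : (E N -> R) -> \bar R) :
  (forall K, finite_set K -> 0 <= norm \1_K)%E ->
  (forall K L, finite_set L -> K `<=` L -> norm \1_K <= norm \1_L)%E ->
  isoperimetric_constant X norm =
  ereal_sup [set (resistance X n * norm \1_(interval0 n))%E | n in [set: E N]].
Proof.
move=> norm_ge0 le_norm; apply/le_anti/andP; split; last first.
  apply: ereal_sup_le => _ [n _ <-]; exists (interval0 n).
    by split; [exact: finite_interval0|exists n => /=; exact: leqnn].
  by rewrite capacity_interval0 inveK muleC.
apply: ge_ereal_sup => _ [K [finK K0] <-].
have [n Kn nK] := finite_set_has_max finK K0.
apply: (@le_trans _ _ (resistance X n * norm \1_(interval0 n))%E); last first.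
  by apply: ereal_sup_ubound; exists n.
rewrite muleC lee_pmul ?inve_ge0 ?capacity_ge0 ?norm_ge0//.
  rewrite inve_ple ?inE ?capacity_ge0 ?resistance_ge0//.
  exact: resistance_inv_le_capacity.
by apply: le_norm => //; exact: finite_interval0.
Qed.

(** * Norms of indicators *)

Section function_space_norm.
Variables (B G : set (E N -> R)) (norm : (E N -> R) -> R).
Hypotheses (B1 : H1 X B) (B2 : H2 B) (B3 : H3 X B norm G) (G0 : G !=set0).

Let pairing_ge0 (f g : E N -> R) (i : E N) :
  G g -> (0 <= (mu_ X (val i) * `|f i| * g i)%:E)%E.
Proof.
move=> Gg; rewrite lee_fin mulr_ge0 ?(proj1 B3)//.
by rewrite mulr_ge0 ?mu_val_ge0.
Qed.

(** Any single element of [G] gives a nonnegative lower bound for the supremum in (H3). *)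
Lemma nfs_norm_ge0 (f : E N -> R) : B f -> 0 <= norm f.
Proof.
move=> Bf; rewrite -lee_fin (proj2 B3)//; have [g Gg] := G0.
apply: (@le_trans _ _ (\esum_(i in [set: E N])
    (mu_ X (val i) * `|f i| * g i)%:E)%E).
  by apply: esum_ge0 => i _; exact: pairing_ge0.
by apply: ereal_sup_ubound; exists g.
Qed.

Lemma nfs_norm_le (f h : E N -> R) :
  B h -> (forall i, `|f i| <= h i) -> norm f <= norm h.
Proof.
move=> Bh fh; rewrite -lee_fin !(proj2 B3)//; last exact: B2 fh.
apply: ge_ereal_sup => _ [g Gg <-].
apply: (@le_trans _ _ (\esum_(i in [set: E N])
    (mu_ X (val i) * `|h i| * g i)%:E)%E); last first.
  by apply: ereal_sup_ubound; exists g.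
apply: le_esum => i _; rewrite lee_fin ler_wpM2r ?(proj1 B3)//.
by rewrite ler_wpM2l ?(le_trans (fh i)) ?ler_norm ?mu_val_ge0.
Qed.

(** When the total mass is finite, (H2) applies with the constant 1 as dominating function. *)
Lemma nfs_indic (K : set (E N)) : finite_set K -> B \1_K.
Proof.
move=> finK; have [muE|muE] := pselect (mu X [set: E N] = +oo%E).
  exact: (proj1 B1).
apply: B2 (proj2 B1 muE) _ => i.
by rewrite indicE ger0_norm ?ler0n// lern1 leq_b1.
Qed.

End function_space_norm.

Lemma mu_interval0 n :
  mu X (interval0 n) = (\sum_(0 <= j < (val n).+1) mu_ X j)%:E.
Proof.
rewrite interval0E /mu esum_fset; last 2 first.
- exact: finite_seq.
- by move=> i _; rewrite lee_fin; exact: mu_val_ge0.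
rewrite -fsbig_seq ?pmap_sub_uniq ?iota_uniq// sumEFin.
by rewrite sum_pmap_insub//; exact: valP.
Qed.

Lemma Lnorm_indic (r : R) (K : set (E N)) : r != 0 ->
  'N[mu X]_(r%:E)[EFin \o \1_K]%E = (mu X K `^ r^-1)%E.
Proof.
move=> r0; rewrite unlock/=; congr (_ `^ _)%E.
rewrite -[in RHS](setIT K) -integral_indic//.
(* Off [K] the integrand is 0 to the power [r], which is 0 because [r != 0]; the power 0 would give
   1. *)
apply: eq_integral => i _ /=.
by rewrite indicE; case: (i \in K); rewrite ?normr1 ?normr0 ?powR1 ?powR0.
Qed.

End birth_death_capacity.

Unset Implicit Arguments.
Set Strict Implicit.

Theorem theorem8p5 (R : realType) (N : option nat) (X : birth_death R N) :
  (forall (B : set (E N -> R)) (norm : (E N -> R) -> R) (G : set (E N -> R)),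
     normed_function_space B norm ->
     H1 X B -> H2 B -> H3 X B norm G ->
     (exists2 g, G g & locally_positive g) ->
     isoperimetric_constant X (fun f => (norm f)%:E) =
     ereal_sup [set (resistance X n * (norm \1_(interval0 n))%:E)%E
               | n in [set: E N]])
  /\
  (forall p : R, 2 <= p ->
     isoperimetric_constant X (fun f => 'N[mu X]_((p / 2)%:E)[EFin \o f]%E) =
     ereal_sup [set (resistance X n
                     * ((\sum_(0 <= j < (\val n).+1) mu_ X j) `^ (2 / p))%:E)%E
               | n in [set: E N]]).
Proof.
split=> [B norm G _ B1 B2 B3 [g Gg _]|p p2].
  have G0 : G !=set0 by exists g.
  apply: isoperimetric_constantE => [K finK|K L finL KL]; rewrite lee_fin.
    by apply: (nfs_norm_ge0 B3 G0); exact: (nfs_indic B1 B2).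
  apply: (nfs_norm_le B2 B3); first exact: (nfs_indic B1 B2).
  move=> i; rewrite !indicE ger0_norm ?ler0n// ler_nat.
  by case: (boolP (i \in K)) => // /set_mem/KL Li; rewrite mem_set.
have p0 : 0 < p by apply: lt_le_trans p2.
have p20 : p / 2 != 0 by rewrite gt_eqF// divr_gt0.
(* Monotonicity is read off [Lnorm_indic]: the norm is a nonnegative power of the mass. *)
rewrite isoperimetric_constantE => [|K _|K L _ KL]; last 2 first.
- exact: Lnorm_ge0.
- rewrite !Lnorm_indic// gt0_ler_poweR ?invr_ge0 ?divr_ge0 ?(ltW p0)//.
  + by rewrite in_itv/= measure_ge0 leey.
  + by rewrite in_itv/= measure_ge0 leey.
  + by rewrite le_measure ?inE.
congr ereal_sup; apply: eq_imagel => n _.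
by rewrite Lnorm_indic// mu_interval0 poweR_EFin invf_div.
Qed.
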